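(* The symmetric functions (formal power series of symmetric functions) $$\frac{\sum_{n\geq 0} e_{2n+1}}{\sum_{n\geq 0} e_{2n}}\qquad\text{and}\qquad \sum_{n\geq 0} Lie_{2n+1}$$ are plethystic inverses of each other.
   Context: We work in the completion (by degree) of the ring of symmetric functions in variables $x_1,x_2,\dots$ over a field of characteristic zero (e.g. $\mathbb{Q}$). $e_n$ is the elementary symmetric function ($e_0=1$) and $p_n$ the power sum. $Lie_n$ is the Frobenius characteristic of the $S_n$-representation on the multilinear component of the free Lie algebra on $n$ generators; explicitly, $Lie_n=\frac1n\sum_{d\mid n}\mu(d)\,p_d^{n/d}$ for $n\ge 1$, where $\mu$ is the number-theoretic Möbius function. Plethysm $f[g]$ (where $g$ has zero constant term, so that it is well defined for series): for fixed $g$, $f\mapsto f[g]$ is the continuous algebra homomorphism fixing constants with $p_n\mapsto p_n[g]$, where $p_n[\cdot]$ is the continuous algebra homomorphism fixing constants with $p_n[p_m]=p_{nm}$. Two series $f,g$ with zero constant term are plethystic inverses if $f[g]=p_1=g[f]$. The quotient is taken in the ring of formal series (the denominator has constant term 1). *)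

(* Defs.v *)
From HB Require Import structures.
From mathcomp Require Import all_boot all_order all_fingroup all_algebra.
From mathcomp Require Import boolp.
From mathcomp Require Import mpoly.

Set Implicit Arguments.
Unset Strict Implicit.
Unset Printing Implicit Defensive.

Import Order.TTheory GRing.Theory Num.Theory.

Local Open Scope ring_scope.

(* Restriction of the number of variables: 'X_n := 0.                         *)
Definition restr_vars (K : fieldType) (n : nat) (p : {mpoly K[n.+1]}) :
    {mpoly K[n]} :=
  p \mPo [tuple oapp (fun j : 'I_n => 'X_j) 0 (unlift ord_max i) | i < n.+1].

(* The degree completion of the ring of symmetric functions in x_0, x_1, ...  *)
(* is \prod_d Lambda^d, where Lambda^d is the inverse limit over n of the     *)
(* spaces of symmetric polynomials in n variables, homogeneous of degree d,   *)
(* along the maps setting the last variable to 0.  Thus [scomp f d n] is the  *)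
(* degree d homogeneous component of f, with x_i := 0 for all i >= n.         *)
Record symser (K : fieldType) := SymSer {
  scomp : forall d n : nat, {mpoly K[n]};
  scomp_sym : forall d n, scomp d n \is symmetric;
  scomp_homog : forall d n, scomp d n \is d.-homog;
  scomp_restr : forall d n, restr_vars (scomp d n.+1) = scomp d n
}.

Section SymSerRing.
Variable K : fieldType.
Local Notation S := (symser K).
Implicit Types (f g h : S) (c : K).

Lemma symserP f g : (forall d n, scomp f d n = scomp g d n) <-> f = g.
Proof.
split=> [|-> //]; case: f g => [f f1 f2 f3] [g g1 g2 g3] /= efg.
have {efg}efg : f = g.
  apply/functional_extensionality_dep=> d.
  exact/functional_extensionality_dep.
case: g / efg g1 g2 g3 => g1 g2 g3.
by congr SymSer; apply: Prop_irrelevance.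
Qed.

HB.instance Definition _ := gen_eqMixin S.
HB.instance Definition _ := gen_choiceMixin S.

Lemma restr_varsD n : {morph @restr_vars K n : p q / p + q}.
Proof. exact: raddfD. Qed.
Lemma restr_varsN n : {morph @restr_vars K n : p / - p}.
Proof. exact: raddfN. Qed.
Lemma restr_varsM n : {morph @restr_vars K n : p q / p * q}.
Proof. by move=> p q; rewrite /restr_vars rmorphM. Qed.
Lemma restr_vars0 n : @restr_vars K n 0 = 0.
Proof. exact: raddf0. Qed.
Lemma restr_vars1 n : @restr_vars K n 1 = 1.
Proof. exact: comp_mpoly1. Qed.
Lemma restr_varsZ n c (p : {mpoly K[n.+1]}) :
  restr_vars (c *: p) = c *: restr_vars p.
Proof. exact: comp_mpolyZ. Qed.
Lemma restr_vars_sum n I (r : seq I) (P : pred I) (F : I -> {mpoly K[n.+1]}) :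
  restr_vars (\sum_(i <- r | P i) F i) = \sum_(i <- r | P i) restr_vars (F i).
Proof. exact: raddf_sum. Qed.

Program Definition symser0 : S := @SymSer K (fun _ _ => 0) _ _ _.
Next Obligation. exact: rpred0. Qed.
Next Obligation. exact: rpred0. Qed.
Next Obligation. exact: restr_vars0. Qed.

Program Definition symser_add f g : S :=
  @SymSer K (fun d n => scomp f d n + scomp g d n) _ _ _.
Next Obligation. by rewrite rpredD ?scomp_sym. Qed.
Next Obligation. by rewrite rpredD ?scomp_homog. Qed.
Next Obligation. by rewrite restr_varsD !scomp_restr. Qed.

Program Definition symser_opp f : S :=
  @SymSer K (fun d n => - scomp f d n) _ _ _.
Next Obligation. by rewrite rpredN ?scomp_sym. Qed.
Next Obligation. by rewrite rpredN ?scomp_homog. Qed.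
Next Obligation. by rewrite restr_varsN !scomp_restr. Qed.

Program Definition symser_scale c f : S :=
  @SymSer K (fun d n => c *: scomp f d n) _ _ _.
Next Obligation. by rewrite rpredZ ?scomp_sym. Qed.
Next Obligation. by rewrite rpredZ ?scomp_homog. Qed.
Next Obligation. by rewrite restr_varsZ !scomp_restr. Qed.

Program Definition symser1 : S := @SymSer K (fun d _ => (d == 0)%N%:R) _ _ _.
Next Obligation. by case: (d == 0)%N; rewrite ?rpred1 ?rpred0. Qed.
Next Obligation. by case: d => [|d]; rewrite ?dhomog1 ?rpred0. Qed.
Next Obligation. by case: d => [|d]; rewrite ?restr_vars1 ?restr_vars0. Qed.

Program Definition symser_mul f g : S :=
  @SymSer K (fun d n => \sum_(i < d.+1) scomp f i n * scomp g (d - i) n) _ _ _.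
Next Obligation. by rewrite rpred_sum // => i _; rewrite rpredM ?scomp_sym. Qed.
Next Obligation.
rewrite rpred_sum // => i _.
have := dhomogM (scomp_homog f i n) (scomp_homog g (d - i) n).
by rewrite subnKC ?leq_ord.
Qed.
Next Obligation.
rewrite restr_vars_sum; apply: eq_bigr => i _.
by rewrite restr_varsM !scomp_restr.
Qed.

Fact symser_addA : associative symser_add.
Proof. by move=> f g h; apply/symserP=> d n /=; rewrite addrA. Qed.
Fact symser_addC : commutative symser_add.
Proof. by move=> f g; apply/symserP=> d n /=; rewrite addrC. Qed.
Fact symser_add0 : left_id symser0 symser_add.
Proof. by move=> f; apply/symserP=> d n /=; rewrite add0r. Qed.
Fact symser_addN : left_inverse symser0 symser_opp symser_add.
Proof. by move=> f; apply/symserP=> d n /=; rewrite addNr. Qed.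

HB.instance Definition _ :=
  GRing.isZmodule.Build S symser_addA symser_addC symser_add0 symser_addN.

Fact symser_mulC : commutative symser_mul.
Proof.
move=> f g; apply/symserP=> d n /=; rewrite (reindex_inj rev_ord_inj) /=.
by apply: eq_bigr => i _; rewrite mulrC subSS subKn ?leq_ord.
Qed.

Let tpoly f (N n : nat) : {poly {mpoly K[n]}} := \poly_(i < N) scomp f i n.

Let tpolyM f g N n d : (d < N)%N ->
  (tpoly f N n * tpoly g N n)`_d = scomp (symser_mul f g) d n.
Proof.
move=> ltdN; rewrite coefM /=; apply: eq_bigr => i _; rewrite !coef_poly.
by rewrite (leq_ltn_trans (leq_ord i) ltdN) (leq_ltn_trans (leq_subr _ _) ltdN).
Qed.

Fact symser_mulA : associative symser_mul.
Proof.
move=> f g h; apply/symserP=> d n.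
transitivity ((tpoly f d.+1 n * (tpoly g d.+1 n * tpoly h d.+1 n))`_d).
  rewrite coefM /=; apply: eq_bigr => i _.
  by rewrite tpolyM ?ltnS ?leq_subr // coef_poly ltn_ord.
rewrite mulrA coefM /=; apply: eq_bigr => i _.
by rewrite tpolyM ?ltn_ord // coef_poly ltnS leq_subr.
Qed.

Fact symser_mul1 : left_id symser1 symser_mul.
Proof.
move=> f; apply/symserP=> d n /=; rewrite big_ord_recl /= mul1r subn0.
by rewrite big1 ?addr0 // => i _; rewrite mul0r.
Qed.

Fact symser_mulDl : left_distributive symser_mul symser_add.
Proof.
move=> f g h; apply/symserP=> d n /=; rewrite -big_split /=.
by apply: eq_bigr => i _; rewrite mulrDl.
Qed.

Fact symser1_neq0 : symser1 != 0 :> S.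
Proof. by apply/eqP=> /symserP/(_ 0%N 0%N)/eqP; rewrite /= oner_eq0. Qed.

HB.instance Definition _ := GRing.Zmodule_isComNzRing.Build S
  symser_mulA symser_mulC symser_mul1 symser_mulDl symser1_neq0.

Fact symser_scaleA a b f :
  symser_scale a (symser_scale b f) = symser_scale (a * b) f.
Proof. by apply/symserP=> d n /=; rewrite scalerA. Qed.
Fact symser_scale1 : left_id 1 symser_scale.
Proof. by move=> f; apply/symserP=> d n /=; rewrite scale1r. Qed.
Fact symser_scaleDr : right_distributive symser_scale +%R.
Proof. by move=> c f g; apply/symserP=> d n /=; rewrite scalerDr. Qed.
Fact symser_scaleDl f : {morph symser_scale^~ f : a b / a + b}.
Proof. by move=> a b; apply/symserP=> d n /=; rewrite scalerDl. Qed.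

HB.instance Definition _ := GRing.Zmodule_isLmodule.Build K S
  symser_scaleA symser_scale1 symser_scaleDr symser_scaleDl.

Fact symser_scaleAl c f g : c *: (f * g) = (c *: f) * g.
Proof.
apply/symserP=> d n /=; rewrite scaler_sumr.
by apply: eq_bigr => i _; rewrite scalerAl.
Qed.

HB.instance Definition _ := GRing.Lmodule_isLalgebra.Build K S symser_scaleAl.
HB.instance Definition _ := GRing.Lalgebra_isComAlgebra.Build K S.

(* The inverse is determined by the ring structure whenever it exists; as     *)
(* always in MathComp, f^-1 := f when f is not invertible.                    *)
Definition symser_unit : pred S := fun f => `[< exists g, g * f = 1 >].
Definition symser_inv f : S :=
  if pselect (exists g, g * f = 1) is left e then sval (cid e) else f.

Fact symser_mulV : {in symser_unit, left_inverse 1 symser_inv *%R}.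
Proof.
by move=> f /asboolP uf; rewrite /symser_inv; case: pselect => // e; case: cid.
Qed.
Fact symser_unitP f g : g * f = 1 -> symser_unit f.
Proof. by move=> e; apply/asboolP; exists g. Qed.
Fact symser_inv_out : {in [predC symser_unit], symser_inv =1 id}.
Proof. by move=> f /asboolP nuf; rewrite /symser_inv; case: pselect. Qed.

HB.instance Definition _ :=
  GRing.ComNzRing_hasMulInverse.Build S symser_mulV symser_unitP symser_inv_out.

End SymSerRing.

Section Topology.
Variable K : fieldType.
Local Notation S := (symser K).

(* The subspaces of series of order >= N are a basis of neighbourhoods of 0.  *)
Definition order_ge (N : nat) (f : S) : Prop :=
  forall d n, (d < N)%N -> scomp f d n = 0.

(* Continuity at 0, which is continuity since Phi is additive.                *)
Definition continuous_hom (Phi : {lrmorphism S -> S}) : Prop :=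
  forall N, exists M, forall f, order_ge M f -> order_ge N (Phi f).

Lemma scompD f g d n : scomp (f + g : S) d n = scomp f d n + scomp g d n.
Proof. by []. Qed.

Lemma scompN f d n : scomp (- f : S) d n = - scomp f d n.
Proof. by []. Qed.

Lemma scomp_sum I (r : seq I) (P : pred I) (F : I -> S) d n :
  scomp (\sum_(i <- r | P i) F i) d n = \sum_(i <- r | P i) scomp (F i) d n.
Proof.
exact: (big_morph (fun f : S => scomp f d n) (fun f g => scompD f g d n)).
Qed.

(* The sum of the series of the u k, when u k has order >= k for all k (see   *)
(* [infsum_cvg]); the value is meaningless otherwise.                         *)
Program Definition infsum (u : nat -> S) : S :=
  @SymSer K (fun d n => \sum_(k < d.+1) scomp (u k) d n) _ _ _.
Next Obligation. by rewrite rpred_sum // => i _; rewrite scomp_sym. Qed.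
Next Obligation. by rewrite rpred_sum // => i _; rewrite scomp_homog. Qed.
Next Obligation.
by rewrite restr_vars_sum; apply: eq_bigr => i _; rewrite scomp_restr.
Qed.

Lemma infsum_cvg (u : nat -> S) : (forall k, order_ge k (u k)) ->
  forall N, order_ge N (infsum u - \sum_(k < N) u k).
Proof.
move=> u_ge N d n ltdN; rewrite scompD scompN scomp_sum /=.
rewrite (big_ord_widen N (fun k => scomp (u k) d n)) //.
rewrite [X in _ - X](bigID (fun k : 'I_N => k < d.+1)%N) /=.
rewrite [X in _ - (_ + X)]big1 ?addr0 ?subrr // => k; rewrite -leqNgt => ltdk.
exact: u_ge.
Qed.

End Topology.

Section Generators.
Variable K : fieldType.
Local Notation S := (symser K).

Lemma restr_varsX n (i : 'I_n.+1) : restr_vars ('X_i : {mpoly K[n.+1]}) =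
  oapp (fun j : 'I_n => 'X_j) 0 (unlift ord_max i).
Proof. by rewrite /restr_vars comp_mpolyXU -tnth_nth tnth_mktuple. Qed.

Lemma restr_vars_widen n (i : 'I_n) :
  restr_vars ('X_(widen_ord (leqnSn n) i) : {mpoly K[n.+1]}) = 'X_i.
Proof.
have -> : widen_ord (leqnSn n) i = lift ord_max i.
  by apply: val_inj; rewrite /= /bump leqNgt ltn_ord.
by rewrite restr_varsX liftK.
Qed.

Lemma restr_varsXn n (p : {mpoly K[n.+1]}) k :
  restr_vars (p ^+ k) = restr_vars p ^+ k.
Proof. by rewrite /restr_vars rmorphXn. Qed.

Lemma restr_varsK n : cancel (@mwiden n K) (@restr_vars K n).
Proof.
move=> p; rewrite [p]mpolyE raddf_sum restr_vars_sum; apply: eq_bigr => m _.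
rewrite /= mwidenZ restr_varsZ; congr (_ *: _).
rewrite mpolyXE_id rmorph_prod [LHS]rmorph_prod; apply: eq_bigr => i _.
rewrite /= rmorphXn rmorphXn /= mwidenX mnmwiden1; congr (_ ^+ _).
exact: restr_vars_widen.
Qed.

Lemma restr_vars_mesym n k :
  restr_vars (mesym n.+1 K k) = mesym n K k.
Proof.
case: k => [|k]; first by rewrite !mesym0E restr_vars1.
rewrite mesymSS restr_varsD restr_varsM !restr_varsK restr_varsX.
by rewrite unlift_none mulr0 addr0.
Qed.

Program Definition elem (k : nat) : S :=
  @SymSer K (fun d n => if d == k then mesym n K k else 0) _ _ _.
Next Obligation. by case: eqP => _; rewrite ?mesym_sym ?rpred0. Qed.
Next Obligation.
case: eqP => [->|_]; last exact: rpred0.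
rewrite mesymE rpred_sum // => h /eqP <-.
by rewrite dhomogX /= mdeg_mesym1.
Qed.
Next Obligation. by case: eqP => _; rewrite ?restr_vars_mesym ?restr_vars0. Qed.

(* There is no power sum p_0 in infinitely many variables: psum 0 = 0.        *)
Program Definition psum (k : nat) : S :=
  @SymSer K (fun d n =>
    if (0 < k)%N && (d == k) then \sum_(i < n) 'X_i ^+ k else 0) _ _ _.
Next Obligation.
case: ifP => _; last exact: rpred0.
apply/issymP=> s; rewrite raddf_sum [RHS](reindex_inj (@perm_inj _ s)) /=.
by apply: eq_bigr => i _; rewrite rmorphXn /= /msym mmapX mmap1U.
Qed.
Next Obligation.
case: ifP => [/andP[_ /eqP ->]|_]; last exact: rpred0.
by rewrite rpred_sum // => i _; rewrite mpolyXn dhomogX /= mdegMn mdeg1 mul1n.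
Qed.
Next Obligation.
case: ifP => [/andP[k_gt0 _]|_]; last exact: restr_vars0.
rewrite big_ord_recr restr_varsD restr_vars_sum /= restr_varsXn restr_varsX.
rewrite unlift_none expr0n eqn0Ngt k_gt0 addr0.
by apply: eq_bigr => i _; rewrite restr_varsXn restr_vars_widen.
Qed.

End Generators.

Arguments elem {K} k.
Arguments psum {K} k.

(* The number-theoretic Moebius function, for n > 0.                          *)
Definition moebius (n : nat) : int :=
  if all (fun p => logn p n == 1%N) (primes n)
  then (-1) ^+ size (primes n) else 0.

(* The classical closed formula for the Frobenius characteristic of the       *)
(* multilinear component of the free Lie algebra on n > 0 generators.         *)
Definition lie_char {K : fieldType} (n : nat) : symser K :=
  n%:R^-1 *: \sum_(d <- divisors n) (moebius d)%:~R *: psum d ^+ (n %/ d).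

Section Plethysm.
Variable K : fieldType.
Local Notation S := (symser K).
Implicit Types (f g : S) (Phi : {lrmorphism S -> S}).

Definition adams_hom (n : nat) Phi : Prop :=
  continuous_hom Phi /\ forall m, (0 < m)%N -> Phi (psum m) = psum (n * m).

(* p_n[g], for n > 0.  In characteristic zero the endomorphism is uniquely    *)
(* determined by [adams_hom n].                                               *)
Definition adams (n : nat) : S -> S :=
  if pselect (exists Phi, adams_hom n Phi) is left e then sval (cid e)
  else fun=> 0.

Definition plethysm_hom g Phi : Prop :=
  continuous_hom Phi /\ forall n, (0 < n)%N -> Phi (psum n) = adams n g.

(* f[g], for g with zero constant term.  In characteristic zero the           *)
(* endomorphism f |-> f[g] is uniquely determined by [plethysm_hom g].        *)
Definition plethysm f g : S :=
  if pselect (exists Phi, plethysm_hom g Phi) is left e then sval (cid e) f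
  else 0.

Definition plethystic_inverses f g : Prop :=
  [/\ order_ge 1 f, order_ge 1 g,
      plethysm f g = psum 1 & plethysm g f = psum 1].

End Plethysm.

(* Main.v *)
(* Let T = (sum e_(2n+1)) / (sum e_(2n)) and L = sum Lie_(2n+1). Newton's
   identities say that, for the Euler (degree) derivation D and
   A = sum_(k odd) p_k / k, one has D T = (1 - T^2) D A, so that artanh T = A.
   On the other side, grouping the terms of L by d gives
   L = sum_(d odd) (mu(d) / d) artanh(p_d). Continuous homomorphisms commute
   with artanh, so L[T] and artanh(T[L]) are the double sums of
   (mu(d) / (d k)) c_(d k) over odd d, k with c = p and c = artanh(p), which
   Moebius inversion collapses to p_1 and artanh(p_1). Only continuity and the
   values on power sums enter, so it does not matter which endomorphisms the
   choice operator picks in [adams] and [plethysm], once they exist. The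
   endomorphism f |-> f[g] is constructed on the elementary functions by the
   fundamental theorem of symmetric polynomials, the images of the e_k being
   obtained from those of the p_k by Newton's recursion. *)
From HB Require Import structures.
Require Import Defs.
From mathcomp Require Import all_boot all_order all_algebra.
From mathcomp Require Import perm boolp mpoly zify ring.

Set Implicit Arguments.
Unset Strict Implicit.
Unset Printing Implicit Defensive.

Import Order.TTheory GRing.Theory Num.Theory.

Local Open Scope ring_scope.

(** * The order filtration *)

Section OrderFiltration.
Variable K : fieldType.
Local Notation S := (symser K).
Implicit Types (f g h : S) (c : K).

Lemma scompM f g d n :
  scomp (f * g) d n = \sum_(i < d.+1) scomp f i n * scomp g (d - i) n.
Proof. by []. Qed.

Lemma scompZ c f d n : scomp (c *: f) d n = c *: scomp f d n.
Proof. by []. Qed.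

Lemma scomp1 d n : scomp (1 : S) d n = (d == 0)%N%:R.
Proof. by []. Qed.

Lemma order_ge0 f : order_ge 0 f.
Proof. by move=> d n. Qed.

Lemma order_ge_0 N : order_ge N (0 : S).
Proof. by []. Qed.

Lemma order_geW M N f : (N <= M)%N -> order_ge M f -> order_ge N f.
Proof. by move=> leNM f_ge d n ltdN; apply: f_ge (leq_trans ltdN leNM). Qed.

Lemma order_geD N f g : order_ge N f -> order_ge N g -> order_ge N (f + g).
Proof. by move=> f_ge g_ge d n lt; rewrite scompD f_ge ?g_ge ?addr0. Qed.

Lemma order_geN N f : order_ge N f -> order_ge N (- f).
Proof. by move=> f_ge d n lt; rewrite scompN f_ge ?oppr0. Qed.

Lemma order_geB N f g : order_ge N f -> order_ge N g -> order_ge N (f - g).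
Proof. by move=> f_ge g_ge; apply/order_geD/order_geN. Qed.

Lemma order_geZ N c f : order_ge N f -> order_ge N (c *: f).
Proof. by move=> f_ge d n lt; rewrite scompZ f_ge ?scaler0. Qed.

Lemma order_ge_sum N I (r : seq I) (P : pred I) (F : I -> S) :
  (forall i, P i -> order_ge N (F i)) -> order_ge N (\sum_(i <- r | P i) F i).
Proof. by move=> F_ge; elim/big_ind: _ => //; apply: order_geD. Qed.

Lemma order_geM M N f g :
  order_ge M f -> order_ge N g -> order_ge (M + N) (f * g).
Proof.
move=> f_ge g_ge d n lt; rewrite scompM big1 // => i _.
have [ltiM|leMi] := ltnP i M; first by rewrite f_ge ?mul0r.
by rewrite g_ge ?mulr0 //; have := ltn_ord i; lia.
Qed.

Lemma order_geMr N f g : order_ge N f -> order_ge N (f * g).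
Proof.
move=> f_ge; rewrite -[N]addn0; apply: order_geM => //; exact: order_ge0.
Qed.

Lemma order_geMl N f g : order_ge N g -> order_ge N (f * g).
Proof. by rewrite mulrC; apply: order_geMr. Qed.

Lemma order_geX N f k : order_ge N f -> order_ge (N * k) (f ^+ k).
Proof.
move=> f_ge; elim: k => [|k IHk]; first by rewrite muln0; apply: order_ge0.
by rewrite mulnS exprS; apply: order_geM.
Qed.

(** The filtration is separated, so identities between series may be checked modulo order N for
    every N, where infinite sums give way to finite ones. *)
Lemma eq_order_ge f g : (forall N, order_ge N (f - g)) -> f = g.
Proof.
move=> fg; apply/symserP=> d n; apply/eqP.
by rewrite -subr_eq0 -scompN -scompD (fg d.+1).
Qed.

Lemma order_ge_sub_trans N f g h :
  order_ge N (f - g) -> order_ge N (g - h) -> order_ge N (f - h).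
Proof. by move=> fg gh; rewrite -(subrK g f) -addrA; apply: order_geD. Qed.

Lemma order_ge_sub_sym N f g : order_ge N (f - g) -> order_ge N (g - f).
Proof. by rewrite -(opprB f); apply: order_geN. Qed.

Lemma scomp_infsum (u : nat -> S) d n :
  scomp (infsum u) d n = \sum_(k < d.+1) scomp (u k) d n.
Proof. by []. Qed.

Lemma eq_infsum (u v : nat -> S) : u =1 v -> infsum u = infsum v.
Proof. by move=> /funext ->. Qed.

Lemma infsumZ c (u : nat -> S) : infsum (fun k => c *: u k) = c *: infsum u.
Proof. by apply/symserP=> d n; rewrite scompZ !scomp_infsum scaler_sumr. Qed.

(** As [infsum] cuts off at the degree, both iterated sums run in degree d over the same finite
    square of indices i, j <= d. *)
Lemma exchange_infsum (u : nat -> nat -> S) :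
  infsum (fun i => infsum (fun j => u i j)) =
  infsum (fun j => infsum (fun i => u i j)).
Proof. by apply/symserP=> d n; apply: exchange_big. Qed.

Lemma order_ge_infsum N (u : nat -> S) :
  (forall k, order_ge N (u k)) -> order_ge N (infsum u).
Proof.
by move=> u_ge d n lt; rewrite scomp_infsum big1 // => k _; apply: u_ge.
Qed.

Lemma infsum_single (u : nat -> S) k : order_ge k (u k) ->
  (forall i, i != k -> u i = 0) -> infsum u = u k.
Proof.
move=> uk_ge u0; apply/symserP=> d n; rewrite scomp_infsum.
have [ltkd|ltdk] := ltnP k d.+1.
  rewrite (bigD1 (Ordinal ltkd)) //= big1 ?addr0 // => i neik.
  by rewrite u0 //; apply: contra neik => /eqP e; apply/eqP/val_inj.
rewrite uk_ge // big1 // => i _; rewrite u0 //.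
by have := ltn_ord i; lia.
Qed.

(** Modulo order N the partial sums are the values at 1 of two polynomials [U] and [V], whose
    product has the Cauchy terms as its first N coefficients. *)
Lemma infsum_cauchy (u v : nat -> S) :
  (forall k, order_ge k (u k)) -> (forall k, order_ge k (v k)) ->
  infsum (fun d => \sum_(i < d.+1) u i * v (d - i)%N) = infsum u * infsum v.
Proof.
move=> u_ge v_ge; pose w d := \sum_(i < d.+1) u i * v (d - i)%N.
have w_ge d : order_ge d (w d).
  apply: order_ge_sum => i _; apply: (@order_geW (i + (d - i))).
    by rewrite subnKC // leq_ord.
  exact: order_geM.
apply: eq_order_ge => N.
pose U := \poly_(i < N) u i; pose V := \poly_(i < N) v i.
apply: (order_ge_sub_trans (@infsum_cvg _ _ w_ge N)).
have -> : \sum_(k < N) w k = \sum_(k < N) (U * V)`_k.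
  apply: eq_bigr => k _; rewrite coefM; apply: eq_bigr => i _.
  rewrite !coef_poly (leq_ltn_trans (leq_ord i)) //.
  by rewrite (leq_ltn_trans (leq_subr _ _)).
have sumE (x : nat -> S) : \sum_(k < N) x k = (\poly_(i < N) x i).[1].
  by rewrite horner_poly; apply: eq_bigr => i _; rewrite expr1n mulr1.
apply: (@order_ge_sub_trans _ _ (U * V).[1]); last first.
  rewrite hornerM -!sumE.
  set a := \sum_(_ < _) _; set b := \sum_(_ < _) _.
  have -> : a * b - infsum u * infsum v =
     - ((infsum u - a) * b + infsum u * (infsum v - b)) by ring.
  apply/order_geN/order_geD; first exact/order_geMr/infsum_cvg.
  exact/order_geMl/infsum_cvg.
(* The first N coefficients of [U * V] cancel against the partial sum; each later one is a sum of
   products of order at least N. *)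
rewrite (@horner_coef_wide _ (N + N)) //; last first.
  apply: leq_trans (size_polyMleq _ _) _.
  by have := size_poly N u; have := size_poly N v; rewrite -/U -/V; lia.
rewrite big_split_ord /= -[X in order_ge _ (X - _)]addr0 opprD addrACA.
apply: order_geD.
  rewrite -sumrB big1 => [|i _]; first exact: order_ge_0.
  by rewrite expr1n mulr1 subrr.
rewrite sub0r; apply/order_geN/order_ge_sum => i _; apply: order_geMr.
rewrite coefM; apply: order_ge_sum => j _.
apply: (@order_geW (j + (N + i - j))); first by have := ltn_ord j; lia.
rewrite !coef_poly; apply: order_geM; case: ifP => _ //; exact: order_ge_0.
Qed.

(** The inverse is the geometric series in 1 - f. *)
Lemma unit_order1 f : order_ge 1 (1 - f) -> f \is a GRing.unit.
Proof.
move=> f_ge; pose x := 1 - f.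
have x_ge k : order_ge k (x ^+ k) by rewrite -{1}[k]mul1n; apply: order_geX.
apply/unitrPr; exists (infsum (fun k => x ^+ k)); apply: eq_order_ge => N.
apply: (@order_ge_sub_trans _ _ (f * \sum_(k < N) x ^+ k)).
  by rewrite -mulrBr; apply/order_geMl/infsum_cvg.
have -> : f * (\sum_(k < N) x ^+ k) = 1 - x ^+ N.
  rewrite -opprB subrX1 -mulNr; congr (_ * _).
  by rewrite /x opprB opprB addrC subrK.
by rewrite addrAC subrr sub0r; apply: order_geN.
Qed.

End OrderFiltration.

(** * Continuous endomorphisms and infinite sums *)

Section ContinuousHom.
Variable K : fieldType.
Local Notation S := (symser K).
Variable Phi : {lrmorphism S -> S}.
Hypothesis Phi_cont : continuous_hom Phi.

(** By continuity some power of [Phi f] has zero constant term. Taking constant terms is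
    multiplicative and polynomials over a field form a domain, so [Phi f] has zero constant term
    too. *)
Lemma continuous_hom_order1 (f : S) : order_ge 1 f -> order_ge 1 (Phi f).
Proof.
move=> f_ge; have [M PhiM] := Phi_cont 1.
have /PhiM : order_ge M (f ^+ M) by rewrite -{1}[M]mul1n; apply: order_geX.
rewrite rmorphXn /= => h d n; rewrite ltnS leqn0 => /eqP ->.
have := h 0%N n isT.
suff -> : forall k, scomp (Phi f ^+ k) 0 n = scomp (Phi f) 0 n ^+ k.
  by move/eqP; rewrite expf_eq0 => /andP[_ /eqP].
elim=> [|k IHk]; first by rewrite scomp1.
by rewrite exprS scompM big_ord1 subn0 IHk exprS.
Qed.

Lemma continuous_hom_infsum (u : nat -> S) :
  (forall k, order_ge k (u k)) -> (forall k, order_ge k (Phi (u k))) ->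
  Phi (infsum u) = infsum (fun k => Phi (u k)).
Proof.
move=> u_ge Phiu_ge; apply: eq_order_ge => N; have [M PhiM] := Phi_cont N.
(* M makes the image of the source tail small, N bounds the tail of the sum of the images. *)
pose M' := maxn M N.
apply: (@order_ge_sub_trans _ _ _ (\sum_(k < M') Phi (u k))).
  rewrite -raddf_sum -raddfB; apply: PhiM.
  by apply: order_geW (@infsum_cvg _ _ u_ge M'); rewrite leq_maxl.
apply: order_ge_sub_sym.
by apply: order_geW (@infsum_cvg _ _ Phiu_ge M'); rewrite leq_maxr.
Qed.

End ContinuousHom.

(** * Newton's identities *)

(** Induction step on the number of variables: e' and p' arise from e and p by adjoining the
    variable x. The index of p is shifted: [p k] stands for the power sum of degree k + 1. *)
Lemma newton_step (R : comNzRingType) (e p e' p' : nat -> R) (x : R) :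
    e' 0%N = e 0%N -> (forall k, e' k.+1 = e k.+1 + e k * x) ->
    (forall k, p' k = p k + x ^+ k.+1) ->
    (forall d, e d *+ d = \sum_(i < d) (-1) ^+ i * e (d - i.+1)%N * p i) ->
  forall d, e' d *+ d = \sum_(i < d) (-1) ^+ i * e' (d - i.+1)%N * p' i.
Proof.
move=> e'0 e'S p'E newt [|d]; first by rewrite big_ord0.
(* The contributions of x ^+ i.+1 to the power sums telescope as the t i.     *)
pose t i := (-1) ^+ i * e (d - i)%N * x ^+ i.+1.
have eE (i : 'I_d) : e' (d - i)%N = e (d - i)%N + e (d - i.+1)%N * x.
  by rewrite -(subnSK (ltn_ord i)) e'S.
transitivity (e d.+1 *+ d.+1 + x * (e d *+ d) + t 0%N).
  by rewrite e'S mulrnDl /t subn0 mulrS; ring.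
have -> : t 0%N = \sum_(i < d) (t i - t i.+1) + t d.
  have := telescope_sumr t (leq0n d); rewrite big_mkord => sumt.
  by rewrite -[LHS](subrK (t d)) -opprB -sumt -sumrN; congr (_ + _);
     apply: eq_bigr => i _; rewrite opprB.
rewrite !newt !big_ord_recr /= !subSS subnn e'0 p'E mulr_sumr /t subnn.
rewrite [in RHS](eq_bigr (fun i : 'I_d => (-1) ^+ i * e (d - i)%N * p i +
   x * ((-1) ^+ i * e (d - i.+1)%N * p i) + (t i - t i.+1))) => [|i _].
  rewrite !big_split /= (eq_bigr (fun i : 'I_d => (-1) ^+ i * e (d - i)%N * p i)) //.
  by ring.
by rewrite subSS eE p'E /t !exprS; ring.
Qed.

Section Newton.
Variable K : fieldType.

Lemma newton_mesym n d : mesym n K d *+ d =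
  \sum_(i < d) (-1) ^+ i * mesym n K (d - i.+1) * \sum_(j < n) 'X_j ^+ i.+1.
Proof.
elim: n d => [|n IHn] d.
  rewrite big1 => [|i _]; last by rewrite big_ord0 mulr0.
  by case: d => // d; rewrite mesym_geqnE ?mul0rn.
pose w := @mwiden n K.
apply: (@newton_step _ (fun k => w (mesym n K k))
  (fun k => w (\sum_(j < n) 'X_j ^+ k.+1)) (mesym n.+1 K)
  (fun k => \sum_(j < n.+1) 'X_j ^+ k.+1) 'X_ord_max) => [|k|k|{}d].
- by rewrite !mesym0E /w rmorph1.
- exact: mesymSS.
- rewrite big_ord_recr /=; congr (_ + _); rewrite /w raddf_sum.
  by apply: eq_bigr => i _; rewrite /= rmorphXn /= mwidenX mnmwiden1.
rewrite /w -raddfMn IHn raddf_sum; apply: eq_bigr => i _.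
by rewrite /= !rmorphM rmorphXn rmorphN1.
Qed.
End Newton.

(** * The Adams endomorphisms *)

Lemma eq_mpoly_hom (K : fieldType) n (A : comNzRingType)
    (F G : {rmorphism {mpoly K[n]} -> A}) :
    (forall c, F c%:MP = G c%:MP) -> (forall i, F 'X_i = G 'X_i) ->
  F =1 G.
Proof.
move=> eqC eqX p; rewrite [p]mpolyE !raddf_sum; apply: eq_bigr => m _.
rewrite -mul_mpolyC [LHS]rmorphM [RHS]rmorphM eqC mpolyXE_id.
congr (_ * _); rewrite [LHS]rmorph_prod [RHS]rmorph_prod.
by apply: eq_bigr => i _; rewrite !rmorphXn /= eqX.
Qed.

Lemma comp_mpoly_tuple (K : fieldType) n m (F : 'I_n -> {mpoly K[m]}) i :
  'X_i \mPo [tuple F j | j < n] = F i.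
Proof. by rewrite comp_mpolyXU -tnth_nth tnth_mktuple. Qed.

Section PowerVariables.
Variable K : fieldType.

(** This is the plethysm p_k[.] in finitely many variables. *)
Definition pow_vars k n (p : {mpoly K[n]}) : {mpoly K[n]} :=
  p \mPo [tuple 'X_i ^+ k | i < n].

HB.instance Definition _ k n := GRing.LRMorphism.copy (@pow_vars k n)
  (comp_mpoly [tuple 'X_i ^+ k | i < n]).

Lemma pow_varsX k n (i : 'I_n) : pow_vars k 'X_i = 'X_i ^+ k.
Proof. exact: comp_mpoly_tuple. Qed.

Lemma pow_vars_sym k n (p : {mpoly K[n]}) :
  p \is symmetric -> pow_vars k p \is symmetric.
Proof.
move=> /issymP p_sym; apply/issymP=> s; rewrite -[in RHS](p_sym s).
apply: (@eq_mpoly_hom _ _ _ (@msym n K s \o @pow_vars k n)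
  (@pow_vars k n \o @msym n K s)) => [c|i] /=.
  by rewrite /pow_vars /msym comp_mpolyC !mmapC comp_mpolyC.
rewrite pow_varsX rmorphXn /=.
have -> : msym s 'X_i = 'X_(s i) :> {mpoly K[n]} by rewrite /msym mmapX mmap1U.
by rewrite pow_varsX.
Qed.

Lemma pow_vars_homog k n d (p : {mpoly K[n]}) :
  p \is d.-homog -> pow_vars k p \is (d * k).-homog.
Proof.
move=> /dhomogP p_homog; rewrite [p]mpolyE /pow_vars raddf_sum.
rewrite big_seq rpred_sum // => m /p_homog <-; rewrite /= comp_mpolyZ rpredZ // comp_mpolyX.
rewrite (eq_bigr (fun i => ('X_i ^+ m i) ^+ k)) => [|i _]; last first.
  by rewrite tnth_mktuple exprAC.
by rewrite prodrXl -mpolyXE_id; apply: dhomogMn; rewrite dhomogX.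
Qed.

Lemma restr_pow_vars k n (p : {mpoly K[n.+1]}) : (0 < k)%N ->
  restr_vars (pow_vars k p) = pow_vars k (restr_vars p).
Proof.
move=> k_gt0; pose r := comp_mpoly
  [tuple oapp (fun j : 'I_n => 'X_j : {mpoly K[n]}) 0 (unlift ord_max i) | i < n.+1].
apply: (@eq_mpoly_hom _ _ _ (r \o @pow_vars k n.+1)
  (@pow_vars k n \o r)) => [c|i] /=.
  by rewrite /pow_vars /r !comp_mpolyC.
rewrite pow_varsX rmorphXn /= /r comp_mpoly_tuple.
case: (unlift _ _) => [j|] /=; first by rewrite pow_varsX.
by rewrite raddf0 expr0n eqn0Ngt k_gt0.
Qed.

End PowerVariables.

(** Used for products of series that live only in degrees divisible by k. *)
Lemma big_dvdn (R : nmodType) k q (F : nat -> R) : (0 < k)%N ->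
  \sum_(i < (k * q).+1 | (k %| i)%N) F i = \sum_(j < q.+1) F (k * j)%N.
Proof.
move=> k_gt0; rewrite (reindex_onto
  (fun j : 'I_q.+1 => inord (k * j)%N : 'I_(k * q).+1)
  (fun i : 'I_(k * q).+1 => inord (i %/ k)%N)) /=; last first.
  move=> i k_i; apply/val_inj; have lti := ltn_ord i.
  have le : (i %/ k <= q)%N by rewrite leq_divLR //; lia.
  by rewrite /= inordK ?inordK // mulnC divnK.
apply: eq_big => [j|j _].
  have le : (k * j < (k * q).+1)%N by rewrite ltnS leq_mul2l leq_ord orbT.
  by rewrite inordK // dvdn_mulr //= mulKn // inord_val eqxx.
by rewrite inordK // ltnS leq_mul2l leq_ord orbT.
Qed.

Section Adams.
Variables (K : fieldType) (k : nat).
Hypothesis k_gt0 : (0 < k)%N.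
Local Notation S := (symser K).

Program Definition adams_series (f : S) : S := @SymSer K
  (fun d n => if (k %| d)%N then pow_vars k (scomp f (d %/ k) n) else 0) _ _ _.
Next Obligation.
by case: ifP => _; rewrite ?rpred0 // pow_vars_sym // scomp_sym.
Qed.
Next Obligation.
case: ifP => [k_d|_]; rewrite ?rpred0 //.
by rewrite -{2}(divnK k_d) pow_vars_homog // scomp_homog.
Qed.
Next Obligation.
by case: ifP => _; rewrite ?restr_vars0 // restr_pow_vars // scomp_restr.
Qed.

Fact adams_series_zmod : zmod_morphism adams_series.
Proof.
move=> f g; apply/symserP=> d n /=; case: ifP => _; last by rewrite subrr.
exact: raddfB.
Qed.

Fact adams_series_scalable : scalable adams_series.
Proof.
move=> c f; apply/symserP=> d n /=; case: ifP => _; last by rewrite scaler0.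
exact: linearZ.
Qed.

Fact adams_series_monoid : monoid_morphism adams_series.
Proof.
split; first apply/symserP=> d n /=.
  case: d => [|d]; first by rewrite dvdn0 div0n rmorph1.
  case: ifP => // k_d; suff -> : (d.+1 %/ k == 0)%N = false by rewrite raddf0.
  by apply/negbTE; rewrite -lt0n divn_gt0 // dvdn_leq.
move=> f g; apply/symserP=> d n; rewrite scompM /=.
case: ifP => [/dvdnP[q]|k_d]; last first.
  rewrite big1 // => i _; case: ifP => k_i; last by rewrite mul0r.
  by rewrite dvdn_subl ?leq_ord ?k_d ?mulr0.
rewrite mulnC => {d} ->; rewrite mulKn // raddf_sum.
rewrite [RHS](bigID (fun i : 'I_ _ => (k %| i)%N)) /= [X in _ + X]big1; last first.
  by move=> i /negbTE ->; rewrite mul0r.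
rewrite addr0 (big_dvdn q (fun i =>
  (if (k %| i)%N then pow_vars k (scomp f (i %/ k)%N n) else 0) *
  (if (k %| k * q - i)%N
   then pow_vars k (scomp g ((k * q - i) %/ k)%N n) else 0))) //.
apply: eq_bigr => i _; rewrite -mulnBr !dvdn_mulr // !mulKn //.
exact: rmorphM.
Qed.

HB.instance Definition _ :=
  GRing.isZmodMorphism.Build S S adams_series adams_series_zmod.
HB.instance Definition _ :=
  GRing.isScalable.Build K S S *:%R adams_series adams_series_scalable.
HB.instance Definition _ :=
  GRing.isMonoidMorphism.Build S S adams_series adams_series_monoid.

Lemma adams_hom_exists : exists Phi : {lrmorphism S -> S}, adams_hom k Phi.
Proof.
exists adams_series; split=> [N|m m_gt0].
  exists N => f f_ge d n ltdN /=; case: ifP => // _.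
  by rewrite f_ge ?raddf0 // (leq_ltn_trans (leq_div d k)).
apply/symserP=> d n /=; rewrite muln_gt0 k_gt0 m_gt0 /=.
case: ifP => [k_d|/negbT k_d]; last by case: eqP k_d => // ->; rewrite dvdn_mulr.
rewrite -(eqn_pmul2l k_gt0) [(k * (d %/ k))%N]mulnC divnK //.
case: ifP => _; last by rewrite raddf0.
rewrite raddf_sum; apply: eq_bigr => i _.
by rewrite /= rmorphXn /= pow_varsX exprM.
Qed.

End Adams.

(** * Endomorphisms with prescribed values on power sums *)

Section NewtonSeries.
Variable K : fieldType.
Local Notation S := (symser K).

Lemma elem0 : elem 0 = 1 :> S.
Proof. by apply/symserP=> d n; rewrite /= mesym0E; case: eqP. Qed.

Lemma psum0 : psum 0 = 0 :> S.
Proof. by apply/symserP. Qed.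

Lemma order_ge_psum k : order_ge k (psum k : S).
Proof. by move=> d n ltdk; rewrite /= (ltn_eqF ltdk) andbF. Qed.

Lemma newton_elem d :
  elem d *+ d = \sum_(i < d) (-1) ^+ i * elem (d - i.+1) * psum i.+1 :> S.
Proof.
apply/symserP=> e n; have scompMn (f : S) k : scomp (f *+ k) e n = scomp f e n *+ k.
  by elim: k => [|k IHk]; rewrite ?mulrS // scompD IHk -mulrS.
have signE i (f : S) m : scomp ((-1) ^+ i * f) m n = (-1) ^+ i * scomp f m n.
  by case: (odd i) (signr_odd S i) (signr_odd {mpoly K[n]} i) => <- <-;
     rewrite ?mulN1r ?mul1r.
rewrite scompMn scomp_sum [scomp (elem d) e n]/=; case: eqP => [->|ned].
  rewrite newton_mesym; apply: eq_bigr => i _.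
  rewrite -[in LHS]mulrA -[in RHS]mulrA signE.
  congr (_ * _); have lt : (d - i.+1 < d.+1)%N by rewrite ltnS leq_subr.
  (* Both factors are homogeneous, so only the splitting of d into d - (i + 1) and i + 1
     contributes. *)
  rewrite scompM (bigD1 (Ordinal lt)) //= eqxx subKn // eqxx.
  rewrite [X in _ + X]big1 ?addr0 // => j.
  by rewrite -val_eqE /= => /negbTE ->; rewrite mul0r.
rewrite mul0rn big1 // => i _; rewrite -mulrA signE scompM big1 ?mulr0 // => j _ /=.
case: eqP => [ej|_]; last by rewrite mul0r.
case: eqP => [ei|_]; last by rewrite mulr0.
by case: ned; have := ltn_ord i; have := ltn_ord j; lia.
Qed.

End NewtonSeries.

(** In the identity for d = k + 1 the term [p k] has coefficient (-1)^k e_0, a sign, so the e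
    determine the p recursively without division. *)
Lemma newton_inj (R : comNzRingType) (e p q : nat -> R) : e 0%N = 1 ->
    (forall d, e d *+ d = \sum_(i < d) (-1) ^+ i * e (d - i.+1)%N * p i) ->
    (forall d, e d *+ d = \sum_(i < d) (-1) ^+ i * e (d - i.+1)%N * q i) ->
  p =1 q.
Proof.
move=> e0 newtp newtq k; elim/ltn_ind: k => k IHk.
have := newtp k.+1; rewrite newtq !big_ord_recr /= subnn e0 mulr1.
rewrite (eq_bigr (fun i : 'I_k => (-1) ^+ i * e (k.+1 - i.+1)%N * p i)); last first.
  by move=> i _; rewrite IHk.
by move/addrI/(congr1 ( *%R ((-1) ^+ k))); rewrite !signrMK.
Qed.

Section NewtonSequence.
Variable K : fieldType.
Hypothesis char0 : [pchar K] =i pred0.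
Local Notation S := (symser K).
Variable b : nat -> S.
Hypothesis b_ge : forall k, order_ge k.+1 (b k).

(* [:: a_k; ...; a_0], where the a_k are related to the b_i as the elementary *)
(* functions e_k are to the power sums p_(i+1).                               *)
Fixpoint newton_seq (k : nat) : seq S :=
  if k is j.+1 then
    j.+1%:R^-1 *: (\sum_(i < j.+1) (-1) ^+ i * (newton_seq j)`_i * b i)
      :: newton_seq j
  else [:: 1].

Definition newton_elems k := (newton_seq k)`_0.

Lemma nth_newton_seq k i : (i <= k)%N -> (newton_seq k)`_i = newton_elems (k - i).
Proof.
elim: k i => [|k IHk] [|i] //; rewrite ltnS => leik.
by rewrite subSS -IHk.
Qed.

Lemma newton_elemsS k : newton_elems k.+1 = k.+1%:R^-1 *:
  \sum_(i < k.+1) (-1) ^+ i * newton_elems (k - i) * b i.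
Proof.
rewrite {1}/newton_elems /=; congr (_ *: _); apply: eq_bigr => i _.
by rewrite nth_newton_seq // leq_ord.
Qed.

Lemma newton_newton_elems d : newton_elems d *+ d =
  \sum_(i < d) (-1) ^+ i * newton_elems (d - i.+1) * b i.
Proof.
case: d => [|d]; first by rewrite big_ord0.
rewrite newton_elemsS -scaler_nat scalerA divff ?scale1r //.
by rewrite (pcharf0P _).1.
Qed.

Lemma order_ge_newton_elems k : order_ge k (newton_elems k).
Proof.
elim/ltn_ind: k => -[|k] IHk; first exact: order_ge0.
rewrite newton_elemsS; apply/order_geZ/order_ge_sum => i _.
apply: (@order_geW _ (k - i + i.+1)); first by have := ltn_ord i; lia.
by apply: order_geM => //; apply/order_geMl/IHk; rewrite ltnS leq_subr.
Qed.

End NewtonSequence.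

Lemma order_ge_prod (K : fieldType) I (r : seq I) (N : I -> nat) (F : I -> symser K) :
  (forall i, order_ge (N i) (F i)) ->
  order_ge (\sum_(i <- r) N i) (\prod_(i <- r) F i).
Proof.
move=> F_ge; elim/big_rec2: _ => [|i f M _ f_ge]; first exact: order_ge0.
exact: order_geM.
Qed.

(** * Evaluation through the elementary functions *)

Section ElemHom.
Variable K : fieldType.
Local Notation S := (symser K).
Variable a : nat -> S.
Hypothesis a_ge : forall k, order_ge k (a k).

Local Notation mesyms n := [tuple mesym n K i.+1 | i < n].

(** The variable of index i plays the role of the elementary function of degree i + 1, whence the
    shift in [a]. *)
Definition elem_subst n : {mpoly K[n]} -> S :=
  mmap (GRing.in_alg S) (fun i : 'I_n => a i.+1).

HB.instance Definition _ n := GRing.RMorphism.copy (@elem_subst n)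
  (mmap (GRing.in_alg S) (fun i : 'I_n => a i.+1)).

Lemma elem_substZ n c (t : {mpoly K[n]}) :
  elem_subst (c *: t) = c *: elem_subst t.
Proof. by rewrite /elem_subst mmapZ /= mulr_algl. Qed.

Lemma elem_substX n (i : 'I_n) : elem_subst 'X_i = a i.+1.
Proof. by rewrite /elem_subst mmapX mmap1U. Qed.

(** The weight [mnmwgt] counts the variable of index i with weight i + 1, which is the order
    guaranteed for [a i.+1]. *)
Lemma elem_subst_order n d (t : {mpoly K[n]}) :
  t \is d.-homog for mnmwgt -> order_ge d (elem_subst t).
Proof.
move=> /dhomogP t_homog; rewrite /elem_subst /mmap big_seq.
apply: order_ge_sum => m /t_homog <-; apply/order_geMl/order_ge_prod => i.
by rewrite mulnC; apply/order_geX/a_ge.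
Qed.

(** Setting the last variable to 0 kills e_(n+1) and turns the other e_i into those in n variables,
    so it acts on polynomials in the e_i by dropping the last of them. *)
Lemma restr_mesyms n (t : {mpoly K[n.+1]}) :
  restr_vars (t \mPo mesyms n.+1) = restr_vars t \mPo mesyms n.
Proof.
pose r := comp_mpoly
  [tuple oapp (fun j : 'I_n => 'X_j : {mpoly K[n]}) 0 (unlift ord_max i) | i < n.+1].
apply: (@eq_mpoly_hom _ _ _ (r \o comp_mpoly (mesyms n.+1))
  (comp_mpoly (mesyms n) \o r)) => [c|i] /=; first by rewrite /r !comp_mpolyC.
rewrite comp_mpoly_tuple [LHS]restr_vars_mesym /r comp_mpoly_tuple.
case: unliftP => [j ->|->] /=; last by rewrite raddf0 mesym_geqnE.
by rewrite comp_mpoly_tuple /bump leqNgt ltn_ord.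
Qed.

(* A monomial of weight at most n does not involve the last variable, whose   *)
(* weight is n + 1.                                                           *)
Lemma elem_subst_restr n d (t : {mpoly K[n.+1]}) : (d <= n)%N ->
  t \is d.-homog for mnmwgt -> elem_subst (restr_vars t) = elem_subst t.
Proof.
move=> ledn /dhomogP t_homog; rewrite [t]mpolyE restr_vars_sum !raddf_sum.
rewrite big_seq [RHS]big_seq; apply: eq_bigr => m /t_homog wgt_m.
rewrite restr_varsZ [LHS]elem_substZ [RHS]elem_substZ; congr (_ *: _).
have m0 : m ord_max = 0%N.
  apply/eqP; rewrite -leqn0 -ltnS ltnNge; apply/negP => m_gt0.
  have : (mnmwgt m <= n)%N by rewrite wgt_m.
  by rewrite /mnmwgt (bigD1 ord_max) //=; nia.
rewrite mpolyXE_id; transitivity (\prod_(i < n.+1) elem_subst (restr_vars 'X_i) ^+ m i).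
  rewrite (big_morph _ (@restr_varsM K n) (restr_vars1 K n)) rmorph_prod.
  by apply: eq_bigr => i _; rewrite restr_varsXn rmorphXn.
rewrite rmorph_prod !big_ord_recr /= m0 !expr0 rmorph1; congr (_ * _).
by apply: eq_bigr => i _; rewrite rmorphXn /= restr_vars_widen !elem_substX.
Qed.

Definition elem_eval d n (f : S) : S :=
  elem_subst (sval (sym_fundamental_homog (scomp_sym f d n) (scomp_homog f d n))).

(** By uniqueness in the fundamental theorem any expression through the elementary polynomials may
    be used; linearity and multiplicativity of the evaluation follow from this. *)
Lemma elem_evalE d n f t :
  t \mPo mesyms n = scomp f d n -> elem_eval d n f = elem_subst t.
Proof.
move=> tE; rewrite /elem_eval; case: sym_fundamental_homog => u /= [uE _].
by congr elem_subst; apply: msym_fundamental_un; rewrite uE.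
Qed.

Lemma elem_evalP d n f : {t : {mpoly K[n]} |
  [/\ t \mPo mesyms n = scomp f d n, t \is d.-homog for mnmwgt &
      elem_eval d n f = elem_subst t]}.
Proof.
by rewrite /elem_eval; case: sym_fundamental_homog => t /= [tE t_homog]; exists t.
Qed.

Lemma elem_eval_order d n f : order_ge d (elem_eval d n f).
Proof. by have [t [_ t_homog ->]] := elem_evalP d n f; apply: elem_subst_order. Qed.

(** An expression in n + 1 variables restricts to one in n variables, and weight d <= n excludes the
    variable that is lost. *)
Lemma elem_eval_stable d n f : (d <= n)%N -> elem_eval d n f = elem_eval d d f.
Proof.
elim: n => [|n IHn]; first by rewrite leqn0 => /eqP ->.
rewrite leq_eqVlt => /predU1P[->//|]; rewrite ltnS => ledn; rewrite -IHn //.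
have [t [tE t_homog ->]] := elem_evalP d n.+1 f.
rewrite -(elem_subst_restr ledn t_homog); apply/esym/elem_evalE.
by rewrite -restr_mesyms tE scomp_restr.
Qed.

Definition elem_hom (f : S) : S := infsum (fun d => elem_eval d d f).

Fact elem_hom_zmod : zmod_morphism elem_hom.
Proof.
move=> f g; apply/symserP=> e n.
rewrite scompD scompN !scomp_infsum -sumrB; apply: eq_bigr => d _.
have [t [tE _ ->]] := elem_evalP d d f; have [u [uE _ ->]] := elem_evalP d d g.
rewrite (@elem_evalE _ _ _ (t - u)); first by rewrite rmorphB.
by rewrite comp_mpolyB tE uE.
Qed.

Fact elem_hom_scalable : scalable elem_hom.
Proof.
move=> c f; rewrite /elem_hom -infsumZ; apply: eq_infsum => d.
have [t [tE _ ->]] := elem_evalP d d f.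
by rewrite (@elem_evalE _ _ _ (c *: t)) ?elem_substZ // comp_mpolyZ tE.
Qed.

Fact elem_hom_monoid : monoid_morphism elem_hom.
Proof.
split=> [|f g].
  have evalE d : elem_eval d d 1 = (d == 0)%N%:R.
    by rewrite (@elem_evalE _ _ _ (d == 0)%N%:R) rmorph_nat.
  rewrite /elem_hom (@infsum_single _ _ 0%N) ?evalE //.
  by move=> d /negbTE d_neq0; rewrite evalE d_neq0.
rewrite -infsum_cauchy => [|k|k]; do ?exact: elem_eval_order.
apply: eq_infsum => d.
(* By stability the components of degrees i and d - i can be evaluated in d variables as well, so
   that all expressions lie in the same polynomial ring. *)
transitivity (\sum_(i < d.+1) elem_eval i d f * elem_eval (d - i) d g); last first.
  apply: eq_bigr => i _; congr (_ * _); apply: elem_eval_stable.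
    by rewrite leq_ord.
  exact: leq_subr.
pose t h i := sval (elem_evalP i d h).
have tP h i :
    t h i \mPo mesyms d = scomp h i d /\ elem_eval i d h = elem_subst (t h i).
  by rewrite /t; case: elem_evalP => ? [].
rewrite (@elem_evalE _ _ _ (\sum_(i < d.+1) t f i * t g (d - i)%N)).
  by rewrite rmorph_sum; apply: eq_bigr => i _; rewrite [LHS]rmorphM !(tP _ _).2.
by rewrite rmorph_sum; apply: eq_bigr => i _; rewrite [LHS]rmorphM /= !(tP _ _).1.
Qed.

HB.instance Definition _ :=
  GRing.isZmodMorphism.Build S S elem_hom elem_hom_zmod.
HB.instance Definition _ :=
  GRing.isScalable.Build K S S *:%R elem_hom elem_hom_scalable.
Lemma elem_hom_exists : exists Phi : {lrmorphism S -> S},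
  continuous_hom Phi /\ forall k, Phi (elem k.+1) = a k.+1.
Proof.
pose M := GRing.isMonoidMorphism.Build S S elem_hom elem_hom_monoid.
pose Phi : {lrmorphism S -> S} := HB.pack elem_hom M.
exists Phi; split=> [N|k /=].
  exists N => f f_ge; apply: order_ge_infsum => d.
  have [ltdN|leNd] := ltnP d N; last exact: (order_geW leNd (@elem_eval_order _ _ _)).
  rewrite (@elem_evalE _ _ _ 0) ?raddf0; first exact: order_ge_0.
  by rewrite f_ge.
rewrite /elem_hom (@infsum_single _ _ k.+1) => [||d neqdk].
(* In k + 1 variables the last generator stands for e_(k+1) itself. *)
- rewrite (@elem_evalE _ _ _ 'X_ord_max) ?elem_substX //.
  by rewrite comp_mpoly_tuple /= eqxx.
- exact: elem_eval_order.
by rewrite (@elem_evalE _ _ _ 0) ?raddf0 //= (negbTE neqdk).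
Qed.

End ElemHom.

Lemma psum_hom_exists (K : fieldType) (b : nat -> symser K) :
  [pchar K] =i pred0 -> (forall k, order_ge k.+1 (b k)) ->
  exists Phi : {lrmorphism symser K -> symser K},
    continuous_hom Phi /\ forall k, Phi (psum k.+1) = b k.
Proof.
move=> char0 b_ge; have a_ge := order_ge_newton_elems b_ge.
have [Phi [Phi_cont Phi_elem]] := elem_hom_exists a_ge.
exists Phi; split=> //.
(* The images of the power sums and the b k satisfy Newton's identities with the same elementary
   sequence, hence agree. *)
apply: (@newton_inj _ (newton_elems b)) => //; last exact: newton_newton_elems.
have elemE k : Phi (elem k) = newton_elems b k.
  by case: k => [|k]; rewrite ?Phi_elem // elem0 rmorph1.
move=> d; rewrite -elemE -raddfMn newton_elem raddf_sum; apply: eq_bigr => i _.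
by rewrite /= !rmorphM /= rmorphXn rmorphN1 elemE.
Qed.

(** * Moebius inversion and artanh *)

Lemma moebius_prime_mul p d : prime p -> (0 < d)%N -> ~~ (p %| d)%N ->
  moebius (p * d) = - moebius d.
Proof.
move=> p_pr d_gt0 pNd; have p_gt0 := prime_gt0 p_pr.
have primes_pd : perm_eq (primes (p * d)) (p :: primes d).
  apply: uniq_perm => [||q]; rewrite ?primes_uniq //=.
    by rewrite primes_uniq mem_primes p_pr d_gt0 pNd.
  by rewrite primesM // primes_prime // inE in_cons.
rewrite /moebius (perm_all _ primes_pd) (perm_size primes_pd) /=.
rewrite lognM // logn_prime // eqxx lognE (negbTE pNd) !andbF addn0 eqxx /=.
have -> : all (fun q => logn q (p * d) == 1%N) (primes d) =
          all (fun q => logn q d == 1%N) (primes d).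
  apply: eq_in_all => q; rewrite mem_primes => /and3P[q_pr _ q_d].
  rewrite lognM // logn_prime //; suff /negbTE -> : q != p by [].
  by apply: contra pNd => /eqP <-.
by case: all; rewrite ?oppr0 // exprS mulN1r.
Qed.

Lemma moebius_square p d : prime p -> (0 < d)%N -> (p ^ 2 %| d)%N ->
  moebius d = 0.
Proof.
move=> p_pr d_gt0 p2_d; rewrite /moebius; case: allP => // /(_ p).
have p_d : (p %| d)%N by apply: dvdn_trans p2_d; rewrite dvdn_exp.
rewrite mem_primes p_pr d_gt0 p_d => /(_ isT) /eqP logp.
by move: p2_d; rewrite pfactor_dvdn // logp.
Qed.

(** Fix a prime p dividing n. Divisors divisible by p^2 contribute 0, and the others cancel in pairs
    d, p d with d prime to p. *)
Lemma sum_moebius n : (0 < n)%N ->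
  \sum_(d <- divisors n) moebius d = (n == 1)%N%:R.
Proof.
move=> n_gt0; have [->|n_neq1] := eqVneq n 1%N.
  by rewrite [divisors 1]/= big_seq1.
have [p p_pr p_n] : exists2 p, prime p & (p %| n)%N.
  exists (pdiv n); last exact: pdiv_dvd.
  by apply: pdiv_prime; case: n n_gt0 n_neq1 => [|[]].
have p_gt0 := prime_gt0 p_pr.
rewrite (bigID (fun d => p %| d)%N) /= addrC.
rewrite [X in _ + X](bigID (fun d => p ^ 2 %| d)%N) /=.
rewrite [X in _ + (X + _)]big_seq_cond [X in _ + (X + _)]big1 ?add0r; last first.
  move=> d /andP[]; rewrite -dvdn_divisors // => d_n /andP[_].
  by apply: moebius_square => //; apply: dvdn_gt0 d_n.
rewrite -[X in _ + X]big_filter [X in _ + X](perm_big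
  [seq (p * d)%N | d <- divisors n & ~~ (p %| d)%N]) /=; last first.
  apply: uniq_perm => [||d]; first by rewrite filter_uniq ?divisors_uniq.
    rewrite map_inj_uniq ?filter_uniq ?divisors_uniq // => x y /eqP.
    by rewrite eqn_pmul2l // => /eqP.
  apply/idP/mapP => [|[e]]; rewrite mem_filter -dvdn_divisors //.
    move=> /andP[/andP[p_d p2_d] d_n]; exists (d %/ p)%N; last first.
      by rewrite mulnC divnK.
    rewrite mem_filter -dvdn_divisors // (dvdn_trans _ d_n) ?andbT.
      by apply: contra p2_d => pp; rewrite -(divnK p_d) mulnC expnS expn1 dvdn_mul.
    by rewrite -{2}(divnK p_d) dvdn_mulr.
  move=> /andP[pNe e_n] ->; rewrite mem_filter -dvdn_divisors // dvdn_mulr //=.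
  rewrite expnS expn1 dvdn_pmul2l // pNe /= Gauss_dvd ?p_n //.
  by rewrite prime_coprime.
rewrite big_map big_filter -big_split /= big_seq_cond big1 // => d.
rewrite -dvdn_divisors // => /andP[d_n pNd].
by rewrite moebius_prime_mul ?subrr // (dvdn_gt0 n_gt0).
Qed.

(** Divisors of an odd number are odd. The free bound D lets all k <= D share one index range. *)
Lemma big_divisors_odd (V : nmodType) k D (G : nat -> V) : (k <= D)%N ->
  \sum_(d <- divisors k.*2.+1) G d =
  \sum_(i < D.+1 | (i.*2.+1 %| k.*2.+1)%N) G i.*2.+1.
Proof.
move=> lekD; rewrite (perm_big
  [seq i.*2.+1 | i <- iota 0 D.+1 & (i.*2.+1 %| k.*2.+1)%N]).
  rewrite big_map big_filter -{1}[D.+1]subn0 -/(index_iota 0 D.+1).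
  exact: (big_mkord (fun i => (i.*2.+1 %| k.*2.+1)%N) (fun i => G i.*2.+1)).
apply: uniq_perm => [||d]; first exact: divisors_uniq.
  by rewrite map_inj_uniq ?filter_uniq ?iota_uniq // => i j; lia.
rewrite -dvdn_divisors //; apply/idP/mapP => [d_k|[i]]; last first.
  by rewrite mem_filter => /andP[? _] ->.
have d_odd : odd d by apply: dvdn_odd d_k _; rewrite /= odd_double.
have dE : d = d./2.*2.+1 by rewrite -[LHS]odd_double_half d_odd.
exists d./2 => //; rewrite mem_filter -dE d_k mem_iota /= add0n.
by have := dvdn_leq (ltn0Sn _) d_k; lia.
Qed.

(** A pair of odd factors determines the odd number they divide. The two finite ranges of pairs
    differ only where the product exceeds D, and there F vanishes. *)
Lemma dirichlet_odd (V : nmodType) D (F : nat -> nat -> V) :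
    (forall d m, (D < d * m)%N -> F d m = 0) ->
  \sum_(k < D.+1) \sum_(d <- divisors k.*2.+1) F d (k.*2.+1 %/ d)%N =
  \sum_(i < D.+1) \sum_(j < D.+1) F i.*2.+1 j.*2.+1.
Proof.
move=> F0; pose H (k i j : nat) :=
  if (i.*2.+1 * j.*2.+1 == k.*2.+1)%N then F i.*2.+1 j.*2.+1 else 0.
transitivity (\sum_(i < D.+1) \sum_(j < D.+1) \sum_(k < D.+1) H k i j).
  under [RHS]eq_bigr do rewrite exchange_big.
  rewrite exchange_big; apply: eq_bigr => k _.
  rewrite (@big_divisors_odd _ _ D) ?leq_ord // big_mkcond /=; apply: eq_bigr => i _.
  case: ifP => [/dvdnP[m mE]|ik]; last first.
    rewrite big1 // => j _; rewrite /H; case: eqP => // e.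
    by rewrite -e dvdn_mulr in ik.
  have m_odd : odd m.
    have : odd (m * i.*2.+1) by rewrite -mE /= odd_double.
    by rewrite oddM => /andP[].
  have m2 : m = m./2.*2.+1 by rewrite -[LHS]odd_double_half m_odd.
  have ltm : (m./2 < D.+1)%N by have := ltn_ord k; nia.
  rewrite (bigD1 (Ordinal ltm)) //= /H -m2 mulnC -mE eqxx mE mulnK // big1 ?addr0 //.
  move=> j; rewrite -val_eqE /= => /eqP neqj; case: eqP => // e; case: neqj.
  by move: e; rewrite mulnC => /eqP; rewrite eqn_pmul2r // {1}m2 => /eqP; lia.
apply: eq_bigr => i _; apply: eq_bigr => j _; rewrite /H.
have [ltD|leD] := ltnP D (i.*2.+1 * j.*2.+1).
  by rewrite F0 // big1 // => k _; case: ifP.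
(* This is the k with (2i + 1)(2j + 1) = 2k + 1. *)
have ltk : (i * j.*2 + i + j < D.+1)%N by rewrite -!muln2 in leD *; nia.
rewrite (bigD1 (Ordinal ltk)) //= ifT; last by apply/eqP; rewrite -!muln2; nia.
rewrite big1 ?addr0 // => k; rewrite -val_eqE /= => /eqP neqk; case: eqP => // e.
by case: neqk; move: e; rewrite -!muln2; nia.
Qed.

(** * The Euler derivation and artanh *)

Section Euler.
Variable K : fieldType.
Local Notation S := (symser K).
Implicit Types (f g u v : S).

Program Definition euler (f : S) : S := @SymSer K
  (fun d n => scomp f d n *+ d) _ _ _.
Next Obligation. by rewrite rpredMn // scomp_sym. Qed.
Next Obligation. by rewrite rpredMn // scomp_homog. Qed.
Next Obligation. by rewrite -scaler_nat restr_varsZ scomp_restr scaler_nat. Qed.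

Lemma scomp_euler f d n : scomp (euler f) d n = scomp f d n *+ d.
Proof. by []. Qed.

Lemma eulerM f g : euler (f * g) = euler f * g + f * euler g.
Proof.
apply/symserP=> d n; rewrite scompD scomp_euler !scompM -sumrMnl -big_split /=.
apply: eq_bigr => i _; rewrite mulrnAl mulrnAr -mulrnDr.
by rewrite subnKC // leq_ord.
Qed.

Lemma eulerZ c f : euler (c *: f) = c *: euler f.
Proof. by apply/symserP=> d n; rewrite /= scalerMnr. Qed.

Lemma eulerX f k : euler (f ^+ k.+1) = f ^+ k * euler f *+ k.+1.
Proof.
elim: k => [|k IHk]; first by rewrite expr1 mul1r.
by rewrite exprS eulerM IHk [RHS]mulrS exprS -mulrnAr; ring.
Qed.

Lemma euler_infsum (u : nat -> S) : euler (infsum u) = infsum (fun k => euler (u k)).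
Proof. by apply/symserP=> d n; rewrite scomp_euler !scomp_infsum -sumrMnl. Qed.

Hypothesis char0 : [pchar K] =i pred0.

Lemma natr_neq0 k : k.+1%:R != 0 :> K.
Proof. by rewrite (pcharf0P _).1. Qed.

(** The derivation multiplies degree d by d, which is invertible for d > 0; degree 0 is excluded by
    the order. *)
Lemma euler_inj f g : order_ge 1 f -> order_ge 1 g -> euler f = euler g -> f = g.
Proof.
move=> f_ge g_ge eq_fg; apply/symserP=> -[|d] n; first by rewrite f_ge ?g_ge.
apply: (scalerI (natr_neq0 d)); rewrite !scaler_nat.
by rewrite -!scomp_euler eq_fg.
Qed.

Definition artanh u : S := infsum (fun j => j.*2.+1%:R^-1 *: u ^+ j.*2.+1).

Lemma artanh0 : artanh 0 = 0.
Proof.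
apply/symserP=> d n; rewrite scomp_infsum big1 // => j _.
by rewrite exprS mul0r scaler0.
Qed.

Lemma order_ge_artanh N u : order_ge N u -> order_ge N (artanh u).
Proof.
move=> u_ge; apply: order_ge_infsum => j; rewrite exprS.
exact/order_geZ/order_geMr.
Qed.

Lemma order_ge_artanh_term c u j : order_ge 1 u -> order_ge j (c *: u ^+ j.*2.+1).
Proof.
move=> u_ge; apply/order_geZ/(@order_geW _ (1 * j.*2.+1)); first by lia.
exact: order_geX.
Qed.

Lemma continuous_hom_artanh (Phi : {lrmorphism S -> S}) u :
  continuous_hom Phi -> order_ge 1 u -> Phi (artanh u) = artanh (Phi u).
Proof.
move=> Phi_cont u_ge; have Phiu_ge := continuous_hom_order1 Phi_cont u_ge.
have PhiE j : Phi (j.*2.+1%:R^-1 *: u ^+ j.*2.+1) =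
    j.*2.+1%:R^-1 *: Phi u ^+ j.*2.+1 by rewrite linearZ /= rmorphXn.
rewrite /artanh continuous_hom_infsum // => [|j|j].
- exact: eq_infsum.
- exact: order_ge_artanh_term.
by rewrite PhiE; apply: order_ge_artanh_term.
Qed.

(** Deriving term by term gives the geometric series in u^2 times [euler u], and the factor 1 - u^2
    telescopes it. *)
Lemma euler_artanh u : order_ge 1 u -> (1 - u ^+ 2) * euler (artanh u) = euler u.
Proof.
move=> u_ge; pose w j := u ^+ j.*2 * euler u.
have w_ge j : order_ge j (w j).
  apply: order_geMr; apply: (@order_geW _ (1 * j.*2)); first by lia.
  exact: order_geX.
have -> : euler (artanh u) = infsum w.
  rewrite euler_infsum; apply: eq_infsum => j; rewrite eulerZ eulerX -scaler_nat.
  by rewrite scalerA mulVf ?scale1r // natr_neq0.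
apply: eq_order_ge => N; apply: (@order_ge_sub_trans _ _ _
  ((1 - u ^+ 2) * \sum_(j < N) w j)).
  by rewrite -mulrBr; apply/order_geMl/infsum_cvg.
rewrite -mulr_suml mulrA (eq_bigr (fun j : 'I_N => (u ^+ 2) ^+ j)); last first.
  by move=> j _; rewrite -exprM mul2n.
rewrite -[1 - _]opprB mulNr -subrX1 opprB mulrBl mul1r addrAC subrr add0r.
apply/order_geN/order_geMr; rewrite -exprM.
by apply: (@order_geW _ (1 * (2 * N))); [lia | exact: order_geX].
Qed.

Lemma order_ge_infsum_head N (w : nat -> S) :
  (forall j, order_ge N (w j.+1)) -> order_ge N (infsum w - w 0%N).
Proof.
move=> w_ge d n lt; rewrite scompD scompN scomp_infsum big_ord_recl addrAC subrr.
by rewrite add0r big1 // => j _; apply: w_ge.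
Qed.

(** Induction on the order: u - v is the leading term of the difference of the artanh, and every
    later term is u - v times a factor of order at least 1, so each step gains one order. *)
Lemma artanh_inj_order N u v : order_ge 1 u -> order_ge 1 v ->
  order_ge N (artanh u - artanh v) -> order_ge N (u - v).
Proof.
move=> u_ge v_ge uv_ge; have uv1 := order_geB u_ge v_ge.
suff H k : (k <= N)%N -> order_ge k (u - v) by apply: H.
elim: k => [|k IHk] lekN; first exact: order_ge0.
have {}IHk := IHk (ltnW lekN).
pose w j := j.*2.+1%:R^-1 *: (u ^+ j.*2.+1 - v ^+ j.*2.+1).
have w0 : w 0%N = u - v by rewrite /w invr1 scale1r !expr1.
have wE : infsum w = artanh u - artanh v.
  apply/symserP=> d n; rewrite scompD scompN !scomp_infsum -sumrB.
  by apply: eq_bigr => j _; rewrite -scompN -scompD /w scalerBr.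
have : order_ge k.+1 (infsum w - w 0%N).
  apply: order_ge_infsum_head => j; apply: order_geZ; rewrite subrXX -addn1.
  apply: order_geM => //; apply: order_ge_sum => i _; have lti := ltn_ord i.
  apply: (@order_geW _ (1 * (j.+1.*2.+1.-1 - i) + 1 * i)); first by lia.
  by apply: order_geM; apply: order_geX.
rewrite w0 wE => /order_ge_sub_sym h.
rewrite -[u - v](subrK (artanh u - artanh v)); apply: order_geD => //.
exact: order_geW uv_ge.
Qed.

Lemma artanh_inj u v : order_ge 1 u -> order_ge 1 v -> artanh u = artanh v -> u = v.
Proof.
move=> u_ge v_ge eq_uv; apply: eq_order_ge => N; apply: artanh_inj_order => //.
by rewrite eq_uv subrr; apply: order_ge_0.
Qed.

Lemma infsum_dirichlet_odd (w : nat -> nat -> S) :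
    (forall d m, order_ge (d * m) (w d m)) ->
  infsum (fun n => \sum_(d <- divisors n.*2.+1) w d (n.*2.+1 %/ d)%N) =
  infsum (fun i => infsum (fun j => w i.*2.+1 j.*2.+1)).
Proof.
move=> w_ge; apply/symserP=> D n; rewrite scomp_infsum.
under eq_bigr do rewrite scomp_sum.
rewrite (@dirichlet_odd _ _ (fun d m => scomp (w d m) D n)) //.
by move=> d m lt; apply: w_ge.
Qed.

(** Grouped by the product n of the two odd indices, c_n receives 1/n times the sum of the Moebius
    function over the divisors of n. *)
Lemma infsum_moebius_odd (c : nat -> S) : (forall k, order_ge k (c k)) ->
  infsum (fun i => infsum (fun j =>
    ((moebius i.*2.+1)%:~R / i.*2.+1%:R / j.*2.+1%:R) *: c (i.*2.+1 * j.*2.+1)%N))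
  = c 1%N.
Proof.
move=> c_ge; pose w d m := ((moebius d)%:~R / d%:R / m%:R : K) *: c (d * m)%N.
rewrite -(@infsum_dirichlet_odd w) => [|d m]; last exact/order_geZ/c_ge.
have wE n : \sum_(d <- divisors n.*2.+1) w d (n.*2.+1 %/ d)%N =
    ((n == 0)%N%:R / n.*2.+1%:R) *: c n.*2.+1.
  rewrite big_seq (eq_bigr (fun d =>
    ((moebius d)%:~R / n.*2.+1%:R) *: c n.*2.+1)) => [|d].
    rewrite -big_seq -scaler_suml -mulr_suml -rmorph_sum sum_moebius //=.
    by rewrite rmorph_nat eqSS double_eq0.
  rewrite -dvdn_divisors // => /dvdnP[m mE].
  have d_gt0 : (0 < d)%N by case: d mE => //; rewrite muln0.
  by rewrite mE /w mulnK // [(d * m)%N]mulnC natrM invfM mulrA mulrAC.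
rewrite (eq_infsum wE) (@infsum_single _ _ 0%N) => [||n /negbTE n_neq0].
- by rewrite invr1 mulr1 scale1r.
- exact: order_ge0.
by rewrite n_neq0 mul0r scale0r.
Qed.

Lemma infsum_lie_odd : infsum (fun n => lie_char n.*2.+1) =
  infsum (fun i => ((moebius i.*2.+1)%:~R / i.*2.+1%:R) *: artanh (psum i.*2.+1)).
Proof.
pose w d m : S := ((moebius d)%:~R / d%:R / m%:R) *: psum d ^+ m.
transitivity (infsum (fun i => infsum (fun j => w i.*2.+1 j.*2.+1))); last first.
  apply: eq_infsum => i; rewrite /artanh -infsumZ; apply: eq_infsum => j.
  by rewrite /w scalerA.
rewrite -infsum_dirichlet_odd => [|d m]; last exact/order_geZ/order_geX/order_ge_psum.
apply: eq_infsum => n; rewrite /lie_char scaler_sumr big_seq [RHS]big_seq.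
apply: eq_bigr => d; rewrite -dvdn_divisors // scalerA => /dvdnP[m mE].
rewrite /w mE; have d_gt0 : (0 < d)%N by case: d mE => //; rewrite muln0.
by rewrite mulnK // natrM invfM mulrC mulrA mulrAC.
Qed.

End Euler.

(** * The two plethysms *)

Section EvenOddElem.
Variable K : fieldType.
Local Notation S := (symser K).

Lemma scomp_infsum_odd (u : nat -> S) d n :
    (forall k e, e != k -> scomp (u k) e n = 0) ->
  scomp (infsum (fun j => u j.*2.+1)) d n = if odd d then scomp (u d) d n else 0.
Proof.
move=> u_conc; rewrite scomp_infsum; case: ifP => [d_odd|d_even]; last first.
  rewrite big1 // => j _; apply: u_conc; apply/eqP=> e.
  by rewrite e /= odd_double in d_even.
have dE : d = d./2.*2.+1 by rewrite -[LHS]odd_double_half d_odd.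
have lt : (d./2 < d.+1)%N by lia.
rewrite (bigD1 (Ordinal lt)) //= -dE big1 ?addr0 // => j neqj; apply: u_conc.
by apply: contra neqj => /eqP e; apply/eqP/val_inj => /=; lia.
Qed.

Lemma scomp_infsum_even (u : nat -> S) d n :
    (forall k e, e != k -> scomp (u k) e n = 0) ->
  scomp (infsum (fun j => u j.*2)) d n = if odd d then 0 else scomp (u d) d n.
Proof.
move=> u_conc; rewrite scomp_infsum; case: ifP => [d_odd|/negbT d_even].
  rewrite big1 // => j _; apply: u_conc; apply/eqP=> e.
  by rewrite e odd_double in d_odd.
have dE : d = d./2.*2 by rewrite -[LHS]odd_double_half (negbTE d_even).
have lt : (d./2 < d.+1)%N by lia.
rewrite (bigD1 (Ordinal lt)) //= -dE big1 ?addr0 // => j neqj; apply: u_conc.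
by apply: contra neqj => /eqP e; apply/eqP/val_inj => /=; lia.
Qed.

Let E : S := infsum (fun n => elem n.*2).
Let O : S := infsum (fun n => elem n.*2.+1).
Let A : S := infsum (fun n => n.*2.+1%:R^-1 *: psum n.*2.+1).
(** The even power sums enter both derivatives below and cancel in that of the quotient O / E. The
    term n = 0 is harmless because [psum 0] is 0. *)
Let B : S := infsum (fun n => psum n.*2).

Lemma scomp_elem_neq n k e : e != k -> scomp (elem k : S) e n = 0.
Proof. by move=> /negbTE /= ->. Qed.

Lemma scomp_psum_neq n k e : e != k -> scomp (psum k : S) e n = 0.
Proof. by move=> /negbTE /= ->; rewrite andbF. Qed.

Let scompE d n : scomp E d n = if odd d then 0 else mesym n K d.
Proof.
by rewrite (scomp_infsum_even _ (@scomp_elem_neq n)) /= eqxx.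
Qed.

Let scompO d n : scomp O d n = if odd d then mesym n K d else 0.
Proof. by rewrite (scomp_infsum_odd _ (@scomp_elem_neq n)) /= eqxx. Qed.

Let scompB d n : scomp B d n = if odd d then 0 else scomp (psum d) d n.
Proof. exact: (scomp_infsum_even _ (@scomp_psum_neq n)). Qed.

Lemma unit_even_elem : E \is a GRing.unit.
Proof.
apply: unit_order1 => d n; rewrite ltnS leqn0 => /eqP ->.
by rewrite scompD scompN scomp1 scompE /= mesym0E subrr.
Qed.

Lemma order_ge1_odd_elem : order_ge 1 O.
Proof. by move=> d n; rewrite ltnS leqn0 => /eqP ->; rewrite scompO. Qed.

Lemma order_ge1_odd_psum : order_ge 1 A.
Proof.
apply: order_ge_infsum => j; apply: order_geZ.
by apply: (@order_geW _ j.*2.+1) => //; apply: order_ge_psum.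
Qed.

(** Newton's identity in the shape of a Cauchy product over all i <= d; the added term i = d
    contains [psum 0], which is 0. *)
Lemma newton_psum0 d n : mesym n K d *+ d = \sum_(i < d.+1)
  (-1) ^+ (d - i).+1 * mesym n K i * scomp (psum (d - i)) (d - i) n.
Proof.
rewrite newton_mesym [RHS](reindex_inj rev_ord_inj) /= big_ord_recl /= subn1 /=.
rewrite subnn mulr0 add0r; apply: eq_bigr => i _.
rewrite /bump leq0n add1n subSS subKn ?(ltn_ord i) // eqxx.
by rewrite !exprS !mulN1r opprK.
Qed.

Hypothesis char0 : [pchar K] =i pred0.

Let scompA d n : scomp (euler A) d n = if odd d then scomp (psum d) d n else 0.
Proof.
rewrite scomp_euler.
rewrite (@scomp_infsum_odd (fun k => k%:R^-1 *: psum k)) => [|k e ek]; last first.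
  by rewrite scompZ scomp_psum_neq ?scaler0.
case: ifP => [d_odd|_]; last by rewrite mul0rn.
rewrite scompZ -scaler_nat scalerA divff ?scale1r //.
by case: d d_odd => // d _; apply: natr_neq0.
Qed.

Let signE d n (p : {mpoly K[n]}) : (-1) ^+ d * p = if odd d then - p else p.
Proof. by rewrite -signr_odd; case: odd; rewrite ?mulN1r ?mul1r. Qed.

(** In even degree the indices i and d - i have equal parity: odd pairs enter Newton's identity with
    sign + and form [O * euler A], even pairs with sign - and form [E * B]. *)
Lemma euler_even_elem : euler E = O * euler A - E * B.
Proof.
apply/symserP=> d n; rewrite scompD scompN scomp_euler !scompM scompE -sumrB.
case: ifP => d_odd.
  rewrite mul0rn big1 // => i _; rewrite scompO scompA scompE scompB.
  by rewrite oddB ?leq_ord // d_odd; case: odd; rewrite ?mul0r ?mulr0 subrr.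
rewrite newton_psum0; apply: eq_bigr => i _.
rewrite -mulrA signE scompO scompA scompE scompB /= oddB ?leq_ord // d_odd.
by case: odd; rewrite /= ?mul0r ?mulr0 ?subr0 ?sub0r.
Qed.

Lemma euler_odd_elem : euler O = E * euler A - O * B.
Proof.
apply/symserP=> d n; rewrite scompD scompN scomp_euler !scompM scompO -sumrB.
case: ifP => d_odd; last first.
  rewrite mul0rn big1 // => i _; rewrite scompO scompA scompE scompB.
  by rewrite oddB ?leq_ord // d_odd; case: odd; rewrite ?mul0r ?mulr0 subrr.
rewrite newton_psum0; apply: eq_bigr => i _.
rewrite -mulrA signE scompO scompA scompE scompB /= oddB ?leq_ord // d_odd.
by case: odd; rewrite /= ?mul0r ?mulr0 ?subr0 ?sub0r.
Qed.

Lemma artanh_odd_even_elem : artanh (O / E) = A.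
Proof.
have T_ge : order_ge 1 (O / E) by apply/order_geMr/order_ge1_odd_elem.
apply: (euler_inj char0); [exact: order_ge_artanh|exact: order_ge1_odd_psum|].
set T := O / E; have TE : T * E = O by rewrite divrK ?unit_even_elem.
have T2_unit : 1 - T ^+ 2 \is a GRing.unit.
  by apply: unit_order1; rewrite opprB addrC subrK exprS; apply: order_geMr.
apply: (mulrI T2_unit); rewrite euler_artanh //; apply: (mulIr unit_even_elem).
(* Deriving T E = O and inserting both derivatives, the terms in [B] cancel and E D T = E (1 - T^2)
   D A remains. *)
have := euler_odd_elem; rewrite -{1}TE eulerM euler_even_elem.
move=> /(canRL (addrK _)) ->.
by rewrite -TE; ring.
Qed.

End EvenOddElem.

(** * Existence of the plethysms *)

Section PlethysmSpec.
Variable K : fieldType.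
Local Notation S := (symser K).

Lemma adamsP n : (0 < n)%N ->
  exists2 Phi : {lrmorphism S -> S}, adams_hom n Phi & @adams K n = Phi.
Proof.
move=> n_gt0; rewrite /adams; case: pselect => [e|[]]; last exact: adams_hom_exists.
by exists (sval (cid e)) => //; case: cid.
Qed.

Hypothesis char0 : [pchar K] =i pred0.

(** The order bounds are those under which [psum_hom_exists] prescribes the values on power sums. *)
Lemma plethysmP (g : S) : (forall n, (0 < n)%N -> order_ge n (adams n g)) ->
  exists2 Phi : {lrmorphism S -> S}, plethysm_hom g Phi & forall f, plethysm f g = Phi f.
Proof.
move=> g_ge; rewrite /plethysm; case: pselect => [e|[]].
  by exists (sval (cid e)) => //; case: cid.
have [Phi [Phi_cont PhiE]] :=
  psum_hom_exists char0 (fun k => g_ge k.+1 (ltn0Sn k)).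
by exists Phi; split=> // -[].
Qed.

End PlethysmSpec.

(** * The quotient of elementary series and the odd Lie series *)

Section OddLie.
Variable K : fieldType.
Hypothesis char0 : [pchar K] =i pred0.
Local Notation S := (symser K).

Let T : S := infsum (fun n => elem n.*2.+1) / infsum (fun n => elem n.*2).
Let L : S := infsum (fun n => lie_char n.*2.+1).

Lemma order_ge1_psum k : order_ge 1 (psum k : S).
Proof.
by case: k => [|k]; rewrite ?psum0 //; apply: order_geW (@order_ge_psum K k.+1).
Qed.

Lemma order_ge1_odd_even_elem : order_ge 1 T.
Proof. exact/order_geMr/order_ge1_odd_elem. Qed.

Lemma order_ge1_odd_lie : order_ge 1 L.
Proof.
rewrite /L infsum_lie_odd; apply: order_ge_infsum => i.
exact/order_geZ/order_ge_artanh/order_ge1_psum.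
Qed.

Lemma artanh_adams_odd_even_elem n : (0 < n)%N -> artanh (adams n T) =
  infsum (fun j => j.*2.+1%:R^-1 *: psum (n * j.*2.+1)).
Proof.
move=> n_gt0; have [Phi [Phi_cont PhiE] ->] := adamsP K n_gt0.
rewrite -continuous_hom_artanh //; last exact: order_ge1_odd_even_elem.
have ZE j : Phi (j.*2.+1%:R^-1 *: psum j.*2.+1) =
  j.*2.+1%:R^-1 *: psum (n * j.*2.+1) by rewrite linearZ /= PhiE.
rewrite artanh_odd_even_elem // continuous_hom_infsum //; first exact: eq_infsum.
  move=> j; apply/order_geZ/(@order_geW _ j.*2.+1); [lia|exact: order_ge_psum].
by move=> j; rewrite ZE; apply/order_geZ/(@order_geW _ (n * j.*2.+1));
   [nia | exact: order_ge_psum].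
Qed.

(** The order is visible on artanh of the image, an explicit series in power sums, and passes to the
    image itself by comparison with artanh 0 = 0. *)
Lemma order_ge_adams_odd_even_elem n : (0 < n)%N -> order_ge n (adams n T).
Proof.
move=> n_gt0; have [Phi [Phi_cont _] adamsE] := adamsP K n_gt0.
have nT_ge : order_ge 1 (adams n T).
  by rewrite adamsE; apply/continuous_hom_order1/order_ge1_odd_even_elem.
rewrite -[adams n T]subr0; apply: artanh_inj_order => //.
rewrite artanh0 subr0 artanh_adams_odd_even_elem //; apply: order_ge_infsum => j.
by apply/order_geZ/(@order_geW _ (n * j.*2.+1)); [nia | exact: order_ge_psum].
Qed.

Lemma adams_odd_lie n : (0 < n)%N -> adams n L =
  infsum (fun i => ((moebius i.*2.+1)%:~R / i.*2.+1%:R) *: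
                     artanh (psum (n * i.*2.+1))).
Proof.
move=> n_gt0; have [Phi [Phi_cont PhiE] ->] := adamsP K n_gt0.
have ZE i (c : K) : Phi (c *: artanh (psum i.*2.+1)) =
    c *: artanh (psum (n * i.*2.+1)).
  rewrite linearZ /= continuous_hom_artanh ?PhiE //; exact: order_ge1_psum.
rewrite /L infsum_lie_odd continuous_hom_infsum //; first exact: eq_infsum.
  move=> i; apply/order_geZ/order_ge_artanh/(@order_geW _ i.*2.+1); first by lia.
  exact: order_ge_psum.
move=> i; rewrite ZE; apply/order_geZ/order_ge_artanh.
by apply: (@order_geW _ (n * i.*2.+1)); [nia | exact: order_ge_psum].
Qed.

Lemma order_ge_adams_odd_lie n : (0 < n)%N -> order_ge n (adams n L).
Proof.
move=> n_gt0; rewrite adams_odd_lie //; apply: order_ge_infsum => i.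
apply/order_geZ/order_ge_artanh/(@order_geW _ (n * i.*2.+1)); first by nia.
exact: order_ge_psum.
Qed.

Lemma plethysm_odd_elem_lie : plethysm T L = psum 1.
Proof.
have [Phi [Phi_cont PhiE] ->] := plethysmP char0 order_ge_adams_odd_lie.
apply: artanh_inj.
- exact/continuous_hom_order1/order_ge1_odd_even_elem.
- exact: order_ge1_psum.
rewrite -continuous_hom_artanh //; last exact: order_ge1_odd_even_elem.
have ZE j (c : K) : Phi (c *: psum j.*2.+1) = c *: adams j.*2.+1 L.
  by rewrite linearZ /= PhiE.
rewrite artanh_odd_even_elem // continuous_hom_infsum //; last first.
- move=> j; rewrite ZE; apply/order_geZ/(@order_geW _ j.*2.+1); first by lia.
  exact: order_ge_adams_odd_lie.
- move=> j; apply/order_geZ/(@order_geW _ j.*2.+1); first by lia.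
  exact: order_ge_psum.
pose c k : S := artanh (psum k).
rewrite -[RHS]/(c 1%N) -infsum_moebius_odd //; last first.
  by move=> k; apply/order_ge_artanh/order_ge_psum.
(* Applying [Phi] to A puts the index of 1/k outside, whereas the Moebius lemma has the index of
   mu(d) outside. *)
rewrite exchange_infsum; apply: eq_infsum => j.
rewrite ZE adams_odd_lie // -infsumZ; apply: eq_infsum => i.
by rewrite scalerA mulrC [(j.*2.+1 * _)%N]mulnC.
Qed.

Lemma plethysm_odd_lie_elem : plethysm L T = psum 1.
Proof.
have [Phi [Phi_cont PhiE] ->] := plethysmP char0 order_ge_adams_odd_even_elem.
have ZE i (c : K) : Phi (c *: artanh (psum i.*2.+1)) = c *:
    infsum (fun j => j.*2.+1%:R^-1 *: psum (i.*2.+1 * j.*2.+1)).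
  rewrite linearZ /= continuous_hom_artanh ?PhiE ?artanh_adams_odd_even_elem //.
  exact: order_ge1_psum.
rewrite /L infsum_lie_odd continuous_hom_infsum //; last first.
- move=> i; rewrite ZE; apply/order_geZ/order_ge_infsum => j; apply/order_geZ.
  by apply: (@order_geW _ (i.*2.+1 * j.*2.+1)); [nia | exact: order_ge_psum].
- move=> i; apply/order_geZ/order_ge_artanh/(@order_geW _ i.*2.+1); first by lia.
  exact: order_ge_psum.
(* Here the double sum is over the power sums themselves and collapses to [psum 1]. *)
rewrite -(infsum_moebius_odd (@order_ge_psum K)).
apply: eq_infsum => i; rewrite ZE -infsumZ; apply: eq_infsum => j.
by rewrite scalerA.
Qed.

End OddLie.

Theorem theorem1p1 (K : fieldType) (char0 : [pchar K] =i pred0) :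
  plethystic_inverses
    (infsum (fun n => elem n.*2.+1) / infsum (fun n => elem n.*2) : symser K)
    (infsum (fun n => lie_char n.*2.+1)).
Proof.
split.
- exact: order_ge1_odd_even_elem.
- exact: order_ge1_odd_lie.
- exact: plethysm_odd_elem_lie.
- exact: plethysm_odd_lie_elem.
Qed.
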